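(* For $k\ge1$ let $\Psi_k$ denote the conjugation-invariant vector field on $\mathrm{SL}(2,\mathbf C)$ defined by the map $g\mapsto g^k-g^{-k}$. These vector fields satisfy the commutator relations $$[\Psi_k,\Psi_l]=(l-k)\Psi_{k+l}-(k+l)\Psi_{l-k}.$$ In particular, the Lie algebra $\mathfrak X_2$ of conjugation-invariant regular vector fields on $\mathrm{SL}(2,\mathbf C)$ is isomorphic to a subalgebra of the Witt algebra, and the vector fields with even index $\{\Psi_{2k}\}_{k\ge1}$ span a subalgebra of $\mathfrak X_2$.
   Context: The vector field defined by a regular conjugation-equivariant map $\Phi:\mathrm{SL}(2,\mathbf C)\to\mathfrak{sl}(2,\mathbf C)$ is $f\mapsto\big(g\mapsto\frac{d}{dt}f(g+tg\Phi(g))|_{t=0}\big)$ for regular functions $f$ (extended to a neighborhood of $\mathrm{SL}(2,\mathbf C)$ in the $2\times2$ matrices). $\Psi_m$ is defined by $g\mapsto g^m-g^{-m}$ for every integer $m$, so that $\Psi_{-m}=-\Psi_m$ and $\Psi_0=0$. $[X,Y]=XY-YX$. The Witt algebra is the complex Lie algebra with basis $f_n$, $n\in\mathbf Z$, and bracket $[f_n,f_m]=(m-n)f_{n+m}$ (algebraic vector fields on $\mathbf C^*$). *)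

(* Defs.v *)
From HB Require Import structures.
From mathcomp Require Import all_boot all_order all_algebra.
From mathcomp Require Import boolp classical_sets functions reals topology.
From mathcomp Require Import normedtype derive.
From mathcomp Require Import complex.
(* The notations of mpoly clash with those of MathComp-Analysis. *)
From mathcomp Require Import -(notations) finmap mpoly monalg.
From mathcomp Require Import ring.

Set Implicit Arguments.
Unset Strict Implicit.
Unset Printing Implicit Defensive.

Import Order.TTheory GRing.Theory Num.Theory numFieldNormedType.Exports.
Local Open Scope classical_set_scope.
Local Open Scope ring_scope.
Local Open Scope complex_scope.

(* Lie algebras are given as subsets, closed under the operations, of a vector
   space carrying a bracket (a commutator or the Witt bracket below). *)
Section Lie.
Variable K : fieldType.

Definition linear_subspace (V : lmodType K) (S : set V) : Prop :=
  S 0 /\ forall (a : K) (x y : V), S x -> S y -> S (a *: x + y).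

Definition linear_span (V : lmodType K) (S : set V) : set V :=
  [set x | exists (n : nat) (a : 'I_n -> K) (b : 'I_n -> V),
     (forall i, S (b i)) /\ x = \sum_(i < n) a i *: b i].

Definition lie_subalgebra (V : lmodType K) (br : V -> V -> V) (S : set V) :=
  linear_subspace S /\ forall x y : V, S x -> S y -> S (br x y).

Definition lie_isomorphism (V W : lmodType K)
    (brV : V -> V -> V) (brW : W -> W -> W)
    (S : set V) (T : set W) (phi : V -> W) : Prop :=
  [/\ set_bij S T phi,
      forall (a : K) (x y : V), S x -> S y ->
        phi (a *: x + y) = a *: phi x + phi y
    & forall x y : V, S x -> S y -> phi (brV x y) = brW (phi x) (phi y)].

End Lie.

(* The Witt algebra: finitely supported functions int -> R[i], f_n being the
   indicator function of n, with the bilinear bracket such that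
   [f_n, f_m] = (m - n) f_(n + m). *)
Definition witt (R : realType) := malg int R[i].

Definition witt_bracket (R : realType) (u v : witt R) : witt R :=
  \sum_(n <- msupp u) \sum_(m <- msupp v)
    mkmalgU (n + m) (mcoeff n u * mcoeff m v * (m - n)%:~R).

Lemma witt_bracket_basis (R : realType) (n m : int) :
  witt_bracket (mkmalgU n 1) (mkmalgU m 1) =
  (m - n)%:~R *: mkmalgU (n + m) 1 :> witt R.
Proof.
rewrite /witt_bracket !msuppU oner_eq0 /= !big_seq_fset1 !mcoeffUU !mul1r.
by apply/malgP => k; rewrite mcoeffZ !mcoeffU mulrnAr mulr1.
Qed.

Lemma ord2_lift : (lift 0 0 = 1 :> 'I_2) * (lift 1 0 = 0 :> 'I_2).
Proof. by split; apply/val_inj. Qed.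

Lemma mxtrace2 (C : comNzRingType) (A : 'M[C]_2) : \tr A = A 0 0 + A 1 1.
Proof. by rewrite /mxtrace !big_ord_recl big_ord0 addr0 ord2_lift. Qed.

Lemma det2 (C : comNzRingType) (A : 'M[C]_2) :
  \det A = A 0 0 * A 1 1 - A 0 1 * A 1 0.
Proof.
rewrite (expand_det_row _ 0) !big_ord_recl big_ord0 ord2_lift /cofactor.
by rewrite !det_mx11 !mxE !ord2_lift /= addr0 expr0 expr1; ring.
Qed.

Lemma forall_ord2 (P : 'I_2 -> Prop) : P 0 -> P 1 -> forall i, P i.
Proof.
move=> P0 P1 [[|[|//]] hi].
  by rewrite (_ : Ordinal _ = 0) //; apply/val_inj.
by rewrite (_ : Ordinal _ = 1) //; apply/val_inj.
Qed.

Lemma mxtrace_adj2 (C : comNzRingType) (A : 'M[C]_2) : \tr (\adj A) = \tr A.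
Proof.
rewrite !mxtrace2 !mxE /cofactor !det_mx11 !mxE !ord2_lift /=.
by rewrite addrC expr0 -signr_odd /= !mul1r.
Qed.

Definition mx2 (C : comNzRingType) (a b c d : C) : 'M[C]_2 := \matrix_(i, j)
  (if i == 0 then (if j == 0 then a else b) else (if j == 0 then c else d)).

Lemma det_1mx2 (C : comNzRingType) (a b c d t : C) :
  \det (1%:M + t *: mx2 a b c d) = (1 + t * a) * (1 + t * d) - t * b * (t * c).
Proof. by rewrite det2 !mxE /=; ring. Qed.

(* Traceless matrices are sums of nilpotent ones. *)
Lemma sl2_nilpotents (C : comNzRingType) (X : 'M[C]_2) : \tr X = 0 ->
  X = (X 0 1 + X 0 0) *: mx2 0 1 0 0 + (X 1 0 - X 0 0) *: mx2 0 0 1 0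
    + X 0 0 *: mx2 1 (-1) 1 (-1).
Proof.
rewrite mxtrace2 => /eqP; rewrite addrC addr_eq0 => /eqP hd.
by apply/matrixP; do 2!apply: forall_ord2; rewrite !mxE /= ?hd; ring.
Qed.

Section SL2.
Variable R : realType.
Local Notation C := (R[i]).

Record SL2 := MkSL2 { SL2_mx :> 'M[C]_2; SL2_det1 : \det SL2_mx == 1 }.

HB.instance Definition _ := [isSub for SL2_mx].
HB.instance Definition _ := [Choice of SL2 by <:].

Lemma SL2_det (g : SL2) : \det (g : 'M_2) = 1.
Proof. exact/eqP/SL2_det1. Qed.

Lemma SL2_one_det : \det (1%:M : 'M[C]_2) == 1.
Proof. by rewrite det1. Qed.

HB.instance Definition _ := isPointed.Build SL2 (MkSL2 SL2_one_det).

Lemma SL2_unit (g : SL2) : (g : 'M_2) \in unitmx.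
Proof. by rewrite unitmxE SL2_det unitr1. Qed.

Lemma SL2_conj_det (h g : SL2) : \det ((h : 'M_2) *m g *m invmx h) == 1.
Proof. by rewrite !det_mulmx det_inv !SL2_det invr1 !mulr1. Qed.

Definition SL2_conj (h g : SL2) : SL2 := MkSL2 (SL2_conj_det h g).

(* Polynomials on 2x2 matrices have the four entries, in row-major order, as
   variables. *)
Definition mx_coord (A : 'M[C]_2) (i : 'I_(2 * 2)) : C := mxvec A 0 i.

Definition mx_eval (P : mpoly (2 * 2) C) (A : 'M[C]_2) : C :=
  meval (mx_coord A) P.

Lemma mx_evalD P Q A : mx_eval (P + Q) A = mx_eval P A + mx_eval Q A.
Proof. exact: mevalD. Qed.

Lemma mx_evalM P Q A : mx_eval (P * Q) A = mx_eval P A * mx_eval Q A.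
Proof. exact: mevalM. Qed.

Definition represents (P : mpoly (2 * 2) C) (f : SL2 -> C) : Prop :=
  forall g : SL2, f g = mx_eval P g.

Definition regular : {pred SL2 -> C} :=
  fun f => `[< exists P : mpoly (2 * 2) C, represents P f >].

Lemma regularP (f : SL2 -> C) :
  reflect (exists P, represents P f) (f \in regular).
Proof. exact: asboolP. Qed.

Lemma regular_const (a : C) : (fun _ => a) \in regular.
Proof. by apply/regularP; exists (mpolyC _ a) => g; rewrite /mx_eval mevalC. Qed.

Lemma regular_entry i j : (fun g : SL2 => (g : 'M_2) i j) \in regular.
Proof.
apply/regularP; exists (mpolyX _ (mnm1 (mxvec_index i j))) => g.
by rewrite /mx_eval mevalXU /mx_coord mxvecE.
Qed.

Lemma regular_add f g : f \in regular -> g \in regular ->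
  (fun x => f x + g x) \in regular.
Proof.
move=> /regularP[P hP] /regularP[Q hQ]; apply/regularP; exists (P + Q) => x.
by rewrite /mx_eval mevalD hP hQ.
Qed.

Lemma regular_mul f g : f \in regular -> g \in regular ->
  (fun x => f x * g x) \in regular.
Proof.
move=> /regularP[P hP] /regularP[Q hQ]; apply/regularP; exists (P * Q) => x.
by rewrite /mx_eval mevalM hP hQ.
Qed.

Lemma regular_opp f : f \in regular -> (fun x => - f x) \in regular.
Proof.
move=> /regularP[P hP]; apply/regularP; exists (- P) => x.
by rewrite /mx_eval mevalN hP.
Qed.

Lemma regular_sum (I : Type) (r : seq I) (F : I -> SL2 -> C) :
  (forall i, F i \in regular) -> (fun x => \sum_(i <- r) F i x) \in regular.
Proof.
move=> hF; elim: r => [|i r ih].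
  rewrite (_ : (fun _ => _) = fun _ => 0); first exact: regular_const.
  by apply/funext => x; rewrite big_nil.
rewrite (_ : (fun _ => _) = fun x => F i x + \sum_(j <- r) F j x).
  exact: regular_add.
by apply/funext => x; rewrite big_cons.
Qed.

Lemma regular_mulmx (A B : SL2 -> 'M[C]_2) :
  (forall i j, (fun g => A g i j) \in regular) ->
  (forall i j, (fun g => B g i j) \in regular) ->
  forall i j, (fun g => (A g *m B g) i j) \in regular.
Proof.
move=> hA hB i j.
rewrite (_ : (fun _ => _) = fun g => \sum_k A g i k * B g k j).
  by apply: regular_sum => k; exact: regular_mul.
by apply/funext => g; rewrite mxE.
Qed.

Lemma regular_subring : subring_closed regular.
Proof.
split=> [|f g hf hg|f g hf hg].
- exact: (regular_const 1).
- exact: (regular_add hf (regular_opp hg)).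
- exact: (regular_mul hf hg).
Qed.

Lemma regular_scale : GRing.scaler_closed regular.
Proof. by move=> a f hf; exact: (regular_mul (regular_const a) hf). Qed.

HB.instance Definition _ :=
  GRing.isSubringClosed.Build _ regular regular_subring.
HB.instance Definition _ := GRing.isScaleClosed.Build _ _ regular regular_scale.

(* The coordinate ring C[SL(2,C)]. *)
Record regfun := MkRegfun {
  regfun_val :> SL2 -> C;
  regfun_regular : regfun_val \in regular }.

HB.instance Definition _ := [isSub for regfun_val].
HB.instance Definition _ := [Choice of regfun by <:].
HB.instance Definition _ := [SubChoice_isSubComNzRing of regfun by <:].
HB.instance Definition _ := [SubZmodule_isSubLmodule of regfun by <:].

Lemma regular_mx_eval (P : mpoly (2 * 2) C) (A : SL2 -> 'M[C]_2) :
  (forall i j, (fun g => A g i j) \in regular) ->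
  (fun g => mx_eval P (A g)) \in regular.
Proof.
move=> hA.
have hc i : (fun g => mx_coord (A g) i) \in regular.
  case/mxvec_indexP: i => i j.
  rewrite (_ : (fun _ => _) = fun g : SL2 => A g i j); first exact: hA.
  by apply/funext => g; rewrite /mx_coord mxvecE.
rewrite (_ : (fun _ => _) = fun g => \sum_(m <- mpoly.msupp P)
    mpoly.mcoeff m P * \prod_i mx_coord (A g) i ^+ m i); last first.
  by apply/funext => g; rewrite /mx_eval mevalE.
apply: regular_sum => m; apply: regular_mul; first exact: regular_const.
rewrite (_ : (fun _ => _) = \prod_i (fun g => mx_coord (A g) i) ^+ m i).
  by apply: rpred_prod => i _; apply: rpredX.
apply/funext => g; rewrite fct_prodE; apply: eq_bigr => i _.
by elim: (m i) => [|k ih]; rewrite ?expr0 // !exprS ih.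
Qed.

Lemma regfun_conj_regular (h : SL2) (f : regfun) :
  (fun g => f (SL2_conj h g)) \in regular.
Proof.
have /regularP[P hP] := regfun_regular f.
rewrite (_ : (fun _ => _) =
    fun g : SL2 => mx_eval P ((h : 'M_2) *m g *m invmx h)); last first.
  by apply/funext => g; rewrite hP.
apply: regular_mx_eval; apply: regular_mulmx => [|k l]; last first.
  exact: regular_const.
by apply: regular_mulmx => k l; [exact: regular_const | exact: regular_entry].
Qed.

Definition regfun_conj (h : SL2) (f : regfun) : regfun :=
  MkRegfun (regfun_conj_regular h f).

Lemma mpoly_ring_ind (Q : mpoly (2 * 2) C -> Prop) :
  (forall c, Q (mpolyC _ c)) -> (forall i, Q (mpolyX _ (mnm1 i))) ->
  (forall P1 P2, Q P1 -> Q P2 -> Q (P1 + P2)) ->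
  (forall P1 P2, Q P1 -> Q P2 -> Q (P1 * P2)) -> forall P, Q P.
Proof.
move=> QC QX QD QM P.
have Q1 : Q 1 by exact: (QC 1).
elim/mpolyind: P => [|c m p _ _ hp]; first by rewrite -mpolyC0; exact: QC.
apply: (QD) => //; rewrite -mul_mpolyC; apply: (QM); first exact: QC.
rewrite mpolyXE_id; apply: big_ind => // i _.
by elim: (m i) => [|k ih]; rewrite ?expr0 // exprS; apply: (QM).
Qed.

(* The derivative in t is the complex one: the base field of derive1 is C. *)
Definition dir_derivative (P : mpoly (2 * 2) C) (A X : 'M[C]_2) : C :=
  derive1 (fun t : C => mx_eval P (A + t *: X) : C^o) 0.

Lemma is_derive_mx_eval (P : mpoly (2 * 2) C) (A X : 'M[C]_2) :
  is_derive (0 : C^o) (1 : C^o) (fun t : C^o => mx_eval P (A + t *: X) : C^o)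
    (\sum_i mx_eval (mderiv i P) A * mx_coord X i).
Proof.
pose Q (P : mpoly (2 * 2) C) :=
  is_derive (0 : C^o) (1 : C^o) (fun t : C^o => mx_eval P (A + t *: X) : C^o)
    (\sum_i mx_eval (mderiv i P) A * mx_coord X i).
have QC c : Q (mpolyC _ c).
  rewrite /Q (_ : (fun _ => _) = cst c); last first.
    by apply/funext => t; rewrite /mx_eval mevalC.
  rewrite big1; first exact: is_derive_cst.
  by move=> i _; rewrite mderivC /mx_eval meval0 mul0r.
have QX i : Q (mpolyX _ (mnm1 i)).
  rewrite /Q (_ : (fun _ => _) =
      (cst (mx_coord A i) : C^o -> C^o) + (mx_coord X i *: id)); last first.
    apply/funext => t; rewrite /mx_eval mevalXU /mx_coord linearD linearZ /=.
    by rewrite !mxE mulrC.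
  have hX : is_derive (0 : C^o) (1 : C^o)
      ((cst (mx_coord A i) : C^o -> C^o) + (mx_coord X i *: id))
      (0 + mx_coord X i *: (1 : C^o)).
    exact: (is_deriveD (is_derive_cst _ _ _) (is_deriveZ _ (is_derive_id _ _))).
  apply: (is_derive_eq hX); rewrite add0r (bigD1 i) //= big1 => [|j ji].
    rewrite mderivX mnm1E eqxx scale1r (_ : mnm_sub _ _ = mnm0); last first.
      by apply/mnmP => k; rewrite mnmBE subnn mnm0E.
    by rewrite mpolyX0 /mx_eval meval1 addr0 mul1r /GRing.scale /= mulr1.
  by rewrite mderivX mnm1E eq_sym (negbTE ji) scale0r /mx_eval meval0 mul0r.
have QD P1 P2 : Q P1 -> Q P2 -> Q (P1 + P2).
  rewrite /Q => h1 h2; have h12 := is_deriveD h1 h2.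
  rewrite (_ : (fun _ => _) = (fun t : C^o => mx_eval P1 (A + t *: X) : C^o) +
      (fun t : C^o => mx_eval P2 (A + t *: X) : C^o)); last first.
    by apply/funext => t; rewrite mx_evalD.
  apply: (is_derive_eq h12); rewrite -big_split; apply: eq_bigr => i _ /=.
  by rewrite mderivD mx_evalD mulrDl.
have QM P1 P2 : Q P1 -> Q P2 -> Q (P1 * P2).
  rewrite /Q => h1 h2; have h12 := is_deriveM h1 h2.
  rewrite (_ : (fun _ => _) = (fun t : C^o => mx_eval P1 (A + t *: X) : C^o) *
      (fun t : C^o => mx_eval P2 (A + t *: X) : C^o)); last first.
    by apply/funext => t; rewrite mx_evalM.
  apply: (is_derive_eq h12); rewrite /= scale0r addr0 /GRing.scale /= !mulr_sumr.
  rewrite -big_split; apply: eq_bigr => i _ /=.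
  rewrite mderivM mx_evalD !mx_evalM mulrDl [RHS]addrC -!mulrA.
  by congr (_ + _); rewrite [RHS]mulrCA.
exact: (mpoly_ring_ind QC QX QD QM).
Qed.

Lemma dir_derivativeE P A X : dir_derivative P A X =
  \sum_i mx_eval (mderiv i P) A * mx_coord X i.
Proof.
by rewrite /dir_derivative derive1E; have := is_derive_mx_eval P A X => -[].
Qed.

Record equivariant_map := EquivariantMap {
  equiv_fun :> SL2 -> 'M[C]_2;
  equiv_regular : forall i j, (fun g => equiv_fun g i j) \in regular;
  equiv_sl2 : forall g, \tr (equiv_fun g) = 0;
  equiv_conj : forall h g : SL2,
    equiv_fun (SL2_conj h g) = (h : 'M_2) *m equiv_fun g *m invmx h }.

(* A polynomial extending f to the space of matrices; by vector_fieldE, the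
   choice does not matter below. *)
Definition extension (f : regfun) : mpoly (2 * 2) C :=
  projT1 (cid (elimT (regularP f) (regfun_regular f))).

Lemma extensionP (f : regfun) : represents (extension f) f.
Proof. by rewrite /extension; case: cid. Qed.

Lemma vector_field_regular (Phi : equivariant_map) (f : regfun) :
  (fun g : SL2 => dir_derivative (extension f) g (g *m Phi g)) \in regular.
Proof.
rewrite (_ : (fun _ => _) = fun g : SL2 =>
    \sum_i mx_eval (mderiv i (extension f)) g * mx_coord (g *m Phi g) i).
  apply: regular_sum => i; apply: regular_mul.
    by apply: regular_mx_eval => k l; exact: regular_entry.
  case/mxvec_indexP: i => i j.
  rewrite (_ : (fun _ => _) = fun g : SL2 => ((g : 'M_2) *m Phi g) i j).
    apply: regular_mulmx => k l; first exact: regular_entry.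
    exact: equiv_regular.
  by apply/funext => g; rewrite /mx_coord mxvecE.
by apply/funext => g; rewrite dir_derivativeE.
Qed.

Definition vector_field (Phi : equivariant_map) (f : regfun) : regfun :=
  MkRegfun (vector_field_regular Phi f).

Lemma dir_derivativeD P A X Y :
  dir_derivative P A (X + Y) = dir_derivative P A X + dir_derivative P A Y.
Proof.
rewrite !dir_derivativeE -big_split; apply: eq_bigr => i _ /=.
by rewrite /mx_coord linearD mxE mulrDr.
Qed.

Lemma dir_derivativeZ P A a X :
  dir_derivative P A (a *: X) = a * dir_derivative P A X.
Proof.
rewrite !dir_derivativeE mulr_sumr; apply: eq_bigr => i _ /=.
by rewrite /mx_coord linearZ mxE mulrCA.
Qed.

Lemma dir_derivative_comb3 P A a b c X Y Z :
  dir_derivative P A (a *: X + b *: Y + c *: Z) =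
  a * dir_derivative P A X + b * dir_derivative P A Y
    + c * dir_derivative P A Z.
Proof.
rewrite (dir_derivativeD P A (_ + _)) (dir_derivativeD P A (a *: X)).
by rewrite (dir_derivativeZ P A a) (dir_derivativeZ P A b) (dir_derivativeZ P A c).
Qed.

(* If X is nilpotent, the line g (1 + t X) lies in SL(2,C). *)
Lemma dir_derivative_eq P Q f (g : SL2) (X : 'M[C]_2) :
  represents P f -> represents Q f -> \tr X = 0 ->
  dir_derivative P g (g *m X) = dir_derivative Q g (g *m X).
Proof.
move=> hP hQ trX.
have nil (N : 'M[C]_2) : (forall t, \det (1%:M + t *: N) = 1) ->
    dir_derivative P g (g *m N) = dir_derivative Q g (g *m N).
  move=> hN; rewrite /dir_derivative.
  suff -> : (fun t : C => mx_eval P ((g : 'M_2) + t *: (g *m N)) : C^o) =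
    (fun t : C => mx_eval Q ((g : 'M_2) + t *: (g *m N)) : C^o) by [].
  apply/funext => t.
  have hd : \det ((g : 'M_2) + t *: (g *m N)) == 1.
    by rewrite -[X in X + _]mulmx1 scalemxAr -mulmxDr det_mulmx SL2_det hN mulr1.
  by have := hP (MkSL2 hd); rewrite hQ => /= ->.
rewrite (sl2_nilpotents trX) !mulmxDr -!scalemxAr !dir_derivative_comb3.
rewrite (nil (mx2 0 1 0 0)) => [|t]; last by rewrite det_1mx2; ring.
rewrite (nil (mx2 0 0 1 0)) => [|t]; last by rewrite det_1mx2; ring.
by rewrite (nil (mx2 1 (-1) 1 (-1))) => [//|t]; rewrite det_1mx2; ring.
Qed.

Lemma vector_fieldE (Phi : equivariant_map) (f : regfun) P (g : SL2) :
  represents P f -> vector_field Phi f g = dir_derivative P g (g *m Phi g).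
Proof.
move=> hP.
exact: (dir_derivative_eq g (@extensionP f) hP (equiv_sl2 Phi g)).
Qed.

Lemma SL2_adj (g : SL2) : invmx (g : 'M_2) = \adj (g : 'M_2).
Proof. by rewrite /invmx SL2_unit SL2_det invr1 scale1r. Qed.

Lemma regular_expn (n : nat) i j :
  (fun g : SL2 => ((g : 'M_2) ^+ n) i j) \in regular.
Proof.
elim: n i j => [|n ih] i j; first exact: regular_const.
rewrite (_ : (fun _ => _) = fun g : SL2 => ((g : 'M_2) *m (g : 'M_2) ^+ n) i j).
  by apply: regular_mulmx => // k l; exact: regular_entry.
by apply/funext => g; rewrite exprS.
Qed.

Lemma regular_expVn (n : nat) i j :
  (fun g : SL2 => (((g : 'M_2)^-1) ^+ n) i j) \in regular.
Proof.
elim: n i j => [|n ih] i j; first exact: regular_const.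
rewrite (_ : (fun _ => _) =
    fun g : SL2 => (\adj (g : 'M_2) *m (g : 'M_2)^-1 ^+ n) i j).
  apply: regular_mulmx => // k l.
  rewrite (_ : (fun _ => _) = fun g : SL2 => (-1) ^+ (l + k) *
      (g : 'M_2) (lift l ord0) (lift k ord0)).
    by apply: regular_mul; [exact: regular_const | exact: regular_entry].
  by apply/funext => g; rewrite mxE /cofactor det_mx11 !mxE.
by apply/funext => g; rewrite exprS -SL2_adj.
Qed.

Lemma regular_exprz (m : int) i j :
  (fun g : SL2 => ((g : 'M_2) ^ m) i j) \in regular.
Proof.
case: m => n; first exact: regular_expn.
rewrite (_ : (fun _ => _) = fun g : SL2 => ((g : 'M_2)^-1 ^+ n.+1) i j).
  exact: regular_expVn.
by apply/funext => g; rewrite NegzE exprVn.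
Qed.

Definition Psi_fun (m : int) (g : SL2) : 'M[C]_2 :=
  (g : 'M_2) ^ m - (g : 'M_2) ^ (- m).

Lemma Psi_fun_regular m i j : (fun g => Psi_fun m g i j) \in regular.
Proof.
rewrite (_ : (fun _ => _) = fun g : SL2 =>
    ((g : 'M_2) ^ m) i j + - ((g : 'M_2) ^ (- m)) i j).
  by apply: regular_add; [|apply: regular_opp]; exact: regular_exprz.
by apply/funext => g; rewrite !mxE.
Qed.

Lemma mxtrace_inv2 (A : 'M[C]_2) : \det A = 1 -> \tr (A^-1) = \tr A.
Proof.
move=> hA; have Au : A \in unitmx by rewrite unitmxE hA unitr1.
by rewrite -[A^-1]/(invmx A) /invmx Au hA invr1 scale1r mxtrace_adj2.
Qed.

Lemma Psi_fun_sl2 m g : \tr (Psi_fun m g) = 0.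
Proof.
have hn n : \tr ((g : 'M_2) ^+ n)^-1 = \tr ((g : 'M_2) ^+ n).
  apply: mxtrace_inv2; elim: n => [|n ih]; first by rewrite expr0 det1.
  by rewrite exprS det_mulmx SL2_det ih mulr1.
rewrite /Psi_fun linearB /= -invr_expz; apply/eqP; rewrite subr_eq0 eq_sym.
by case: m => n; rewrite ?NegzE -?exprnN ?invrK -?exprnP hn.
Qed.

Lemma exprz_conj (U : unitRingType) (u a : U) (m : int) :
  u \is a GRing.unit -> a \is a GRing.unit ->
  (u * a * u^-1) ^ m = u * a ^ m * u^-1.
Proof.
move=> uu ua.
have hn n : (u * a * u^-1) ^+ n = u * a ^+ n * u^-1.
  elim: n => [|n ih]; first by rewrite !expr0 mulr1 divrr.
  by rewrite !exprS ih !mulrA mulrVK.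
case: m => n; first exact: hn.
rewrite NegzE -!exprnN hn invrM ?unitrMl ?unitrMr ?unitrV ?unitrX // invrK.
by rewrite invrM ?unitrX // mulrA.
Qed.

Lemma SL2_conj_exprz m (h g : SL2) :
  (SL2_conj h g : 'M_2) ^ m = (h : 'M_2) *m (g : 'M_2) ^ m *m invmx h.
Proof. by apply: (@exprz_conj 'M[C]_2); exact: SL2_unit. Qed.

Lemma Psi_fun_conj m (h g : SL2) :
  Psi_fun m (SL2_conj h g) = (h : 'M_2) *m Psi_fun m g *m invmx h.
Proof. by rewrite /Psi_fun !SL2_conj_exprz mulmxBr mulmxBl. Qed.

Definition Psi_map (m : int) : equivariant_map :=
  EquivariantMap (Psi_fun_regular m) (Psi_fun_sl2 m) (Psi_fun_conj m).

Definition Psi (m : int) : regfun -> regfun := vector_field (Psi_map m).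

(* A regular vector field is a C-linear derivation of the coordinate ring. *)
Definition derivation (D : regfun -> regfun) : Prop :=
  linear D /\ forall f g : regfun, D (f * g) = D f * g + f * D g.

Definition conj_invariant (D : regfun -> regfun) : Prop :=
  forall (h : SL2) (f : regfun), D (regfun_conj h f) = regfun_conj h (D f).

Definition invariant_vector_fields : set (regfun -> regfun) :=
  [set D | derivation D /\ conj_invariant D].

Definition commutator (X Y : regfun -> regfun) : regfun -> regfun :=
  fun f => X (Y f) - Y (X f).
End SL2.

Arguments Psi : clear implicits.
Arguments invariant_vector_fields : clear implicits.
Arguments commutator : clear implicits.

(* Main.v *)
(* An invariant field D commutes with conjugation by the diagonal torus
   z |-> diag(z, 1/z), which fixes the torus pointwise and scales the
   off-diagonal entries; hence D is tangent to the torus and restricts there to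
   u(z) z d/dz for a Laurent polynomial u.  Since z^n (z d/dz) is the element
   f_n of the Witt algebra, D |-> u is a Lie algebra map, and it is injective
   because the conjugates of the torus are dense.  It sends Psi_m to
   f_m - f_(-m), so the commutator relations are read off in the Witt
   algebra. *)
Require Import Defs.
From mathcomp Require Import all_boot all_order all_algebra.
From mathcomp Require Import boolp classical_sets functions reals complex.
From mathcomp Require Import -(notations) finmap mpoly monalg.
From mathcomp Require Import ring zify.

Set Implicit Arguments.
Unset Strict Implicit.
Unset Printing Implicit Defensive.

Import Order.TTheory GRing.Theory Num.Theory.
Local Open Scope classical_set_scope.
Local Open Scope ring_scope.

(** * Polynomials and Laurent polynomials determined by their values *)

Lemma poly_cofinite_eq0 (K : numFieldType) (q r : {poly K}) :
  r != 0 -> (forall z, r.[z] != 0 -> q.[z] = 0) -> q = 0.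
Proof.
move=> r0 hq; apply/eqP; rewrite -[_ == 0]orFb -(negbTE r0) -mulf_eq0.
apply/eqP; set s := r * q.
(* In characteristic zero the naturals below [size s] are distinct roots of [s], too many for a
   nonzero polynomial of that size. *)
apply: (@roots_geq_poly_eq0 _ _ [seq i%:R | i <- iota 0 (size s)]).
- apply/allP => z _; apply/rootP; rewrite hornerM.
  by have [->|/hq ->] := eqVneq r.[z] 0; rewrite ?mul0r ?mulr0.
- rewrite map_inj_in_uniq ?iota_uniq // => i j _ _ /eqP.
  by rewrite eqr_nat => /eqP.
- by rewrite size_map size_iota.
Qed.

Section Laurent.
Variable K : numFieldType.
Implicit Types (u v : malg int K) (z : K) (n : int).

(** Evaluation at [z] of the Laurent polynomial with coefficients [u]. *)
Definition laurent z u : K := monalg.mmap idfun (fun n => z ^ n) u.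

(** Evaluation at [z] of the Euler operator z d/dz applied to [u]. *)
Definition laurent_euler z u : K :=
  monalg.mmap idfun (fun n => n%:~R * z ^ n) u.

Lemma laurentE z u : laurent z u = \sum_(n <- msupp u) mcoeff n u * z ^ n.
Proof. by []. Qed.

Lemma laurent_eulerE z u :
  laurent_euler z u = \sum_(n <- msupp u) mcoeff n u * (n%:~R * z ^ n).
Proof. by []. Qed.

Lemma laurentU z n c : laurent z (mkmalgU n c) = c * z ^ n.
Proof. exact: mmapU. Qed.

Lemma laurent_eulerU z n c :
  laurent_euler z (mkmalgU n c) = c * (n%:~R * z ^ n).
Proof. exact: mmapU. Qed.

Lemma laurentD z u v : laurent z (u + v) = laurent z u + laurent z v.
Proof. exact: mmapD. Qed.

Lemma laurent_eulerD z u v :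
  laurent_euler z (u + v) = laurent_euler z u + laurent_euler z v.
Proof. exact: mmapD. Qed.

Lemma laurentB z u v : laurent z (u - v) = laurent z u - laurent z v.
Proof. exact: mmapB. Qed.

Lemma laurent_sum (I : Type) (r : seq I) (F : I -> malg int K) z :
  laurent z (\sum_(i <- r) F i) = \sum_(i <- r) laurent z (F i).
Proof. exact: raddf_sum. Qed.

Lemma laurent_euler_sum (I : Type) (r : seq I) (F : I -> malg int K) z :
  laurent_euler z (\sum_(i <- r) F i) = \sum_(i <- r) laurent_euler z (F i).
Proof. exact: raddf_sum. Qed.

Lemma laurent_eulerB z u v :
  laurent_euler z (u - v) = laurent_euler z u - laurent_euler z v.
Proof. exact: mmapB. Qed.

Lemma laurentZ z c u : laurent z (c *: u) = c * laurent z u.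
Proof.
rewrite malgZ_def /fgscale laurent_sum mulr_sumr; apply: eq_bigr => n _.
by rewrite laurentU mulrA.
Qed.

Lemma laurent_eq0 u : (forall z, z != 0 -> laurent z u = 0) -> u = 0.
Proof.
(* [N] bounds the absolute value of every exponent, so multiplication by [z ^+ N] clears the
   negative powers. *)
move=> hu; pose N := (\sum_(n <- msupp u) `|n|)%N.
have hN n : n \in (msupp u : seq int) -> 0 <= n + N%:Z.
  move=> nu; have : (`|n| <= N)%N.
    by rewrite /N (big_rem n) //= leq_addr.
  by lia.
pose q : {poly K} := \sum_(n <- msupp u) mcoeff n u *: 'X^(absz (n + N%:Z)).
have q0 : q = 0.
  apply: (@poly_cofinite_eq0 _ _ 'X); first by rewrite polyX_eq0.
  move=> z; rewrite hornerX => z0.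
  transitivity (z ^+ N * laurent z u); last by rewrite hu ?mulr0.
  rewrite /q horner_sum laurentE mulr_sumr big_seq [RHS]big_seq.
  apply: eq_bigr => n /hN nN; rewrite hornerZ hornerXn [RHS]mulrCA !exprnP.
  by rewrite gez0_abs // addrC expfzDr.
apply/malgP => n; rewrite mcoeff0; have [nu|/mcoeff_outdom //] :=
  boolP (n \in msupp u).
(* The shifted exponents are nonnegative, so [absz] keeps them distinct and this coefficient of [q]
   is the one of [u] at [n]. *)
have /= := congr1 (fun p : {poly K} => p`_(absz (n + N%:Z))) q0.
rewrite coef0 /q coef_sum (big_rem n) //= coefZ coefXn eqxx mulr1.
rewrite big_seq big1 ?addr0 // => m.
rewrite mem_rem_uniq ?fset_uniq // inE => /andP[mn /hN mN].
rewrite coefZ coefXn; case: eqP => [h|]; last by rewrite mulr0.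
have := hN _ nu => nN; exfalso; move/eqP: mn; apply; lia.
Qed.

Lemma laurent_inj u v :
  (forall z, z != 0 -> laurent z u = laurent z v) -> u = v.
Proof.
move=> uv; apply/eqP; rewrite -subr_eq0; apply/eqP/laurent_eq0 => z z0.
by rewrite laurentB uv ?subrr.
Qed.

(** The convolution of [u] and [v] serves as [w]; the second identity is the Leibniz rule for z
    d/dz. *)
Lemma laurent_mul u v : exists w, forall z, z != 0 ->
  laurent z w = laurent z u * laurent z v /\
  laurent_euler z w =
    laurent_euler z u * laurent z v + laurent z u * laurent_euler z v.
Proof.
exists (\sum_(n <- msupp u) \sum_(m <- msupp v)
  mkmalgU (n + m) (mcoeff n u * mcoeff m v)) => z z0; split.
  rewrite laurent_sum !laurentE mulr_suml; apply: eq_bigr => n _.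
  rewrite laurent_sum mulr_sumr; apply: eq_bigr => m _.
  by rewrite laurentU expfzDr // mulrACA.
rewrite laurent_euler_sum !laurent_eulerE !laurentE !mulr_suml -big_split.
apply: eq_bigr => n _; rewrite laurent_euler_sum !mulr_sumr -big_split.
apply: eq_bigr => m _; rewrite laurent_eulerU expfzDr //= intrD; ring.
Qed.

End Laurent.

(** With E = z d/dz this is the commutator of vector fields [u E, v E] = (u E(v) - v E(u)) E,
    checked on monomials. *)
Lemma laurent_witt_bracket (R : realType) (u v : witt R) (z : R[i]) :
  z != 0 -> laurent z (witt_bracket u v) =
    laurent z u * laurent_euler z v - laurent z v * laurent_euler z u.
Proof.
move=> z0; rewrite /witt_bracket laurent_sum !laurent_eulerE !laurentE.
rewrite [X in _ = _ - X]mulrC !mulr_suml -sumrB.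
apply: eq_bigr => n _; rewrite laurent_sum !mulr_sumr -sumrB.
apply: eq_bigr => m _; rewrite laurentU expfzDr //= intrB; ring.
Qed.

(** * Explicit 2x2 matrices, the diagonal torus and diagonalization *)

Lemma mx2_eta (K : comNzRingType) (A : 'M[K]_2) :
  A = mx2 (A 0 0) (A 0 1) (A 1 0) (A 1 1).
Proof. by apply/matrixP; do 2!apply: forall_ord2; rewrite !mxE. Qed.

Lemma mul_mx2 (K : comNzRingType) (a b c d a' b' c' d' : K) :
  mx2 a b c d *m mx2 a' b' c' d' =
  mx2 (a * a' + b * c') (a * b' + b * d') (c * a' + d * c') (c * b' + d * d').
Proof.
by apply/matrixP; do 2!apply: forall_ord2;
  rewrite !mxE !big_ord_recl big_ord0 addr0 !mxE !ord2_lift.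
Qed.

Lemma adj_mx2 (K : comNzRingType) (a b c d : K) :
  \adj (mx2 a b c d) = mx2 d (- b) (- c) a.
Proof.
by apply/matrixP; do 2!apply: forall_ord2;
  rewrite !mxE /cofactor det_mx11 !mxE !ord2_lift /=; ring.
Qed.

Lemma det_mx2 (K : comNzRingType) (a b c d : K) :
  \det (mx2 a b c d) = a * d - b * c.
Proof. by rewrite det2 !mxE. Qed.

Lemma SL2_conjE (R : realType) (g : SL2 R) (a b c d : R[i])
    (hd : \det (mx2 a b c d) == 1) :
  SL2_conj (MkSL2 hd) g = mx2 a b c d *m g *m mx2 d (- b) (- c) a :> 'M_2.
Proof. by rewrite /= -[in RHS]adj_mx2 -(SL2_adj (MkSL2 hd)). Qed.

Lemma torus_det (R : realType) (z : R[i]) :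
  z != 0 -> \det (mx2 z 0 0 z^-1) == 1.
Proof. by move=> z0; rewrite det_mx2 mulfV // mul0r subr0. Qed.

Definition torus (R : realType) (z : R[i]) (z0 : z != 0) : SL2 R :=
  MkSL2 (torus_det z0).

Lemma torus_conj (R : realType) (s z : R[i]) (s0 : s != 0) (z0 : z != 0) :
  SL2_conj (torus s0) (torus z0) = torus z0.
Proof.
apply: val_inj; apply: etrans (SL2_conjE _ _) _; rewrite /= !mul_mx2.
by congr mx2; field; rewrite ?s0 ?z0.
Qed.

Lemma SL2_mul_det (R : realType) (h k : SL2 R) : \det ((h : 'M_2) *m k) == 1.
Proof. by rewrite det_mulmx !SL2_det mulr1. Qed.

Lemma SL2_conj_comp (R : realType) (h k g : SL2 R) :
  SL2_conj h (SL2_conj k g) = SL2_conj (MkSL2 (SL2_mul_det h k)) g.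
Proof.
apply: val_inj => /=.
by rewrite -![invmx _]/(_^-1) invrM ?SL2_unit // !mulmxA.
Qed.

(* The columns of the conjugating matrix are eigenvectors of g. *)
Lemma SL2_diagonalizable (R : realType) (g : SL2 R) :
  (g : 'M_2) 0 1 != 0 -> (\tr (g : 'M_2)) ^+ 2 != 4 ->
  exists h z (z0 : z != 0), SL2_conj h (torus z0) = g.
Proof.
rewrite mxtrace2; have := SL2_det g; rewrite det2.
set a := SL2_mx g 0 0; set b := SL2_mx g 0 1; set c := SL2_mx g 1 0.
set d := SL2_mx g 1 1 => hdet b0 ht.
pose s : R[i] := sqrtC ((a + d) ^+ 2 - 4).
have hs : s ^+ 2 = (a + d) ^+ 2 - 4 by rewrite sqrtCK.
have s0 : s != 0 by rewrite sqrtC_eq0 subr_eq0.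
(* The roots of the characteristic polynomial; they differ because the discriminant [s ^+ 2] is
   nonzero. *)
pose z := (a + d + s) / 2; pose w := (a + d - s) / 2.
have hzw : z * w = 1.
  rewrite /z /w; transitivity (((a + d) ^+ 2 - s ^+ 2) / 4); first by field.
  by rewrite hs; field.
have z0 : z != 0.
  by rewrite -unitfE; apply/unitrP; exists w; rewrite mulrC hzw.
have hw : z^-1 = w by apply: (mulfI z0); rewrite mulfV.
(* Scales the second eigenvector so that the matrix of eigenvectors has determinant 1. *)
pose k := (b * (w - z))^-1.
have wz : w - z = - s by rewrite /w /z; field.
have zw : z + w = a + d by rewrite /z /w; field.
have bc : c * b = a * d - z * w by rewrite hzw -hdet; ring.
have hh : \det (mx2 b (b * k) (z - a) ((w - a) * k)) == 1.
  rewrite det_mx2; apply/eqP; transitivity (b * (w - z) * k); first by ring.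
  rewrite mulfV // mulf_neq0 //.
  by rewrite wz oppr_eq0.
exists (MkSL2 hh), z, z0; apply: val_inj => /=.
have -> : mx2 b (b * k) (z - a) ((w - a) * k) *m mx2 z 0 0 z^-1 =
    (g : 'M_2) *m mx2 b (b * k) (z - a) ((w - a) * k).
  rewrite [SL2_mx g]mx2_eta !mul_mx2 hw -/a -/b -/c -/d.
  have da : d = z + w - a by rewrite zw; ring.
  congr mx2; first by ring.
  - by ring.
  - by rewrite bc da; ring.
  - by rewrite (mulrA c) bc da; ring.
by rewrite -mulmxA mulmxV ?mulmx1 // unitmxE (eqP hh) unitr1.
Qed.

(** * Polynomial and regular functions; density of the conjugates of the torus *)

Lemma mx_eval_line (R : realType) (P : mpoly (2 * 2) R[i]) (A B : 'M[R[i]]_2) :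
  exists q : {poly R[i]}, forall t, mx_eval P (A + t *: B) = q.[t].
Proof.
elim/mpoly_ring_ind: P => [c|i|P1 P2 [q1 h1] [q2 h2]|P1 P2 [q1 h1] [q2 h2]].
- by exists c%:P => t; rewrite hornerC /mx_eval mevalC.
- exists ((mx_coord A i)%:P + mx_coord B i *: 'X) => t.
  rewrite hornerD hornerZ hornerC hornerX /mx_eval mevalXU /mx_coord.
  by rewrite linearD linearZ /= !mxE mulrC.
- by exists (q1 + q2) => t; rewrite mx_evalD h1 h2 hornerD.
- by exists (q1 * q2) => t; rewrite mx_evalM h1 h2 hornerM.
Qed.

(** With [B] the inverse of [A], this gives a conjugated regular function an extension to all
    matrices that is again an explicit conjugate. *)
Lemma mx_eval_conj (R : realType) (P : mpoly (2 * 2) R[i]) (A B : 'M[R[i]]_2) :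
  exists Q, forall X, mx_eval Q X = mx_eval P (A *m X *m B).
Proof.
elim/mpoly_ring_ind: P => [c|i|P1 P2 [q1 h1] [q2 h2]|P1 P2 [q1 h1] [q2 h2]].
- by exists (mpolyC _ c) => X; rewrite /mx_eval !mevalC.
- case/mxvec_indexP: i => i j.
  exists (\sum_k (\sum_l A i l *: mpolyX _ (mnm1 (mxvec_index l k))) *
    mpolyC _ (B k j)) => X.
  rewrite /mx_eval mevalXU /mx_coord mxvecE mxE raddf_sum /=.
  apply: eq_bigr => k _; rewrite mevalM mevalC mxE raddf_sum /=; congr (_ * _).
  by apply: eq_bigr => l _; rewrite mevalZ mevalXU mxvecE.
- by exists (q1 + q2) => t; rewrite !mx_evalD h1 h2.
- by exists (q1 * q2) => t; rewrite !mx_evalM h1 h2.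
Qed.

Section Regfun.
Variable R : realType.
Local Notation C := (R[i]).
Implicit Types (f : regfun R) (g : SL2 R) (P : mpoly (2 * 2) C).

Lemma regfun_eqP f f' : (forall g, f g = f' g) -> f = f'.
Proof. by move=> h; apply/val_inj/funext. Qed.

Lemma regfunD f f' g : (f + f') g = f g + f' g.
Proof. by []. Qed.

Lemma regfunB f f' g : (f - f') g = f g - f' g.
Proof. by []. Qed.

Lemma regfunM f f' g : (f * f') g = f g * f' g.
Proof. by []. Qed.

Lemma regfunZ (c : C) f g : (c *: f) g = c * f g.
Proof. by []. Qed.

Lemma regfun_of_regular P : (fun g : SL2 R => mx_eval P g) \in regular (R := R).
Proof. by apply/regularP; exists P. Qed.

Definition regfun_of P : regfun R := MkRegfun (regfun_of_regular P).

Lemma regfun_of_extension f : f = regfun_of (extension f).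
Proof. by apply: regfun_eqP => g; rewrite /= (extensionP f). Qed.

Lemma regfun_ofD P Q : regfun_of (P + Q) = regfun_of P + regfun_of Q.
Proof. by apply: regfun_eqP => g; rewrite regfunD /= mx_evalD. Qed.

Lemma regfun_ofM P Q : regfun_of (P * Q) = regfun_of P * regfun_of Q.
Proof. by apply: regfun_eqP => g; rewrite regfunM /= mx_evalM. Qed.

Lemma regfun_ofC c : regfun_of (mpolyC _ c) = c *: (1 : regfun R).
Proof.
by apply: regfun_eqP => g; rewrite regfunZ /= /mx_eval mevalC mulr1.
Qed.

Definition entry (i j : 'I_2) : regfun R :=
  regfun_of (mpolyX _ (mnm1 (mxvec_index i j))).

Lemma entryE i j g : entry i j g = (g : 'M_2) i j.
Proof. by rewrite /= /mx_eval mevalXU /mx_coord mxvecE. Qed.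

(* A non-diagonal g lies, up to a Weyl conjugation, on a line in SL(2,C) of
   matrices with upper right entry fixed and nonzero, along which the trace is
   not constant; all but finitely many points of it are diagonalizable. *)
Lemma regfun_dense f :
  (forall h (z : C) (z0 : z != 0), f (SL2_conj h (torus z0)) = 0) -> f = 0.
Proof.
move=> hf; apply: regfun_eqP => g; rewrite [RHS]/=.
have up (h k : SL2 R) : (k : 'M_2) 0 1 != 0 -> f (SL2_conj h k) = 0.
  move=> b0; rewrite -[f _]/(regfun_conj h f k); set f' := regfun_conj h f.
  have hf' l (z : C) (z0 : z != 0) : f' (SL2_conj l (torus z0)) = 0.
    by rewrite /f' /= SL2_conj_comp hf.
  (* [N] is nilpotent, so [k (1 + t N)] stays in SL(2,C); the second column of [k N] is zero, so the
     upper right entry does not move. *)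
  pose N : 'M[C]_2 := mx2 0 0 1 0.
  have [q hq] := mx_eval_line (extension f') k ((k : 'M_2) *m N).
  have dett t : \det ((k : 'M_2) + t *: ((k : 'M_2) *m N)) == 1.
    rewrite -[X in X + _]mulmx1 scalemxAr -mulmxDr det_mulmx SL2_det.
    by rewrite det_1mx2 mul1r; apply/eqP; ring.
  have kN : (k : 'M_2) *m N = mx2 ((k : 'M_2) 0 1) 0 ((k : 'M_2) 1 1) 0.
    by rewrite [in LHS](mx2_eta k) mul_mx2; congr mx2; ring.
  have q0 : q = 0.
    apply: (@poly_cofinite_eq0 _ _
      ((\tr (k : 'M_2) *: 1 + (k : 'M_2) 0 1 *: 'X) ^+ 2 - 4%:P)).
      (* At this parameter the trace equals 3, so the polynomial takes the nonzero value 9 - 4 =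
         5. *)
      apply/eqP => /(congr1 (fun p : {poly C} =>
        p.[(3 - \tr (k : 'M_2)) / (k : 'M_2) 0 1])).
      rewrite !hornerE /= mulrAC mulfV // mul1r (addrC (\tr _)) subrK => /eqP.
      by rewrite (_ : _ - _ = 5%:R) ?pnatr_eq0 //; ring.
    move=> t; rewrite !hornerE => ht.
    rewrite -hq -(extensionP f' (MkSL2 (dett t))).
    have [||l [z [z0 <-]]] := @SL2_diagonalizable R (MkSL2 (dett t)).
    - by rewrite /= kN !mxE /= mulr0 addr0.
    - apply: contra_neq ht; rewrite mxtrace2 /= kN !mxE /= => <-.
      by rewrite mxtrace2; ring.
    exact: hf'.
  rewrite (extensionP f' k) -[SL2_mx k]addr0 -(scale0r ((k : 'M_2) *m N)).
  by rewrite hq q0 horner0.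
have [b0|b0] := eqVneq ((g : 'M_2) 0 1) 0; last first.
  rewrite (_ : g = SL2_conj (MkSL2 (SL2_one_det R)) g) ?up //.
  by apply: val_inj; rewrite /= mul1mx invmx1 mulmx1.
have [c0|c0] := eqVneq ((g : 'M_2) 1 0) 0.
  have := SL2_det g; rewrite det2 b0 mul0r subr0 => hg.
  have z0 : (g : 'M_2) 0 0 != 0.
    by rewrite -unitfE; apply/unitrP; exists ((g : 'M_2) 1 1); rewrite mulrC hg.
  rewrite (_ : g = SL2_conj (torus z0) (torus z0)) ?hf // torus_conj.
  apply: val_inj; rewrite /= [LHS]mx2_eta b0 c0; congr mx2.
  by apply: (mulfI z0); rewrite hg mulfV.
(* The Weyl element and its inverse: conjugation by the first carries the nonzero lower left entry,
   up to sign, to the upper right. *)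
have hd1 : \det (mx2 0 1 (-1) 0 : 'M[C]_2) == 1.
  by rewrite det_mx2; apply/eqP; ring.
have hd2 : \det (mx2 0 (-1) 1 0 : 'M[C]_2) == 1.
  by rewrite det_mx2; apply/eqP; ring.
have e1 : SL2_conj (MkSL2 hd1) g = mx2 ((g : 'M_2) 1 1) (- (g : 'M_2) 1 0)
    (- (g : 'M_2) 0 1) ((g : 'M_2) 0 0) :> 'M_2.
  by rewrite SL2_conjE [in LHS](mx2_eta g) !mul_mx2; congr mx2; ring.
rewrite (_ : g = SL2_conj (MkSL2 hd2) (SL2_conj (MkSL2 hd1) g)) ?up //.
  by rewrite e1 mxE oppr_eq0.
apply: val_inj; apply/esym/(etrans (SL2_conjE _ _)).
by rewrite e1 [RHS]/= [in RHS](mx2_eta g) !mul_mx2; congr mx2; ring.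
Qed.

End Regfun.

(** * Linear spans and the subalgebras they generate *)

Section Linear_span.
Variables (K : fieldType) (V : lmodType K).
Implicit Types S U : set V.

Lemma linear_subspaceZ S a x : linear_subspace S -> S x -> S (a *: x).
Proof. by case=> S0 SL Sx; rewrite -[_ *: _]addr0; exact: SL. Qed.

Lemma linear_subspaceB S x y : linear_subspace S -> S x -> S y -> S (x - y).
Proof.
by move=> hS Sx Sy; rewrite -scaleN1r addrC; exact: hS.2.
Qed.

Lemma linear_span_gen S x : S x -> linear_span S x.
Proof.
by move=> Sx; exists 1, (fun=> 1), (fun=> x); rewrite big_ord1 scale1r.
Qed.

Lemma linear_span_subspace S : linear_subspace (linear_span S).
Proof.
split.
  exists 0, (fun=> 0), (fun=> 0); split; first by case.
  by rewrite big_ord0.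
move=> c _ _ [n [a [b [Sb ->]]]] [m [a' [b' [Sb' ->]]]].
exists (n + m)%N,
  (fun i => match fintype.split i with
            | inl j => c * a j | inr j => a' j end),
  (fun i => match fintype.split i with inl j => b j | inr j => b' j end).
split=> [i|]; first by case: fintype.split.
rewrite big_split_ord scaler_sumr; congr (_ + _); apply: eq_bigr => i _.
  by rewrite (unsplitK (inl i)) scalerA.
by rewrite (unsplitK (inr i)).
Qed.

Lemma linear_span_sub S U :
  linear_subspace U -> S `<=` U -> linear_span S `<=` U.
Proof.
move=> [U0 UL] SU _ [n [a [b [Sb ->]]]]; elim/big_ind: _ => // [x y Ux Uy|i _].
  by rewrite -[x]scale1r; exact: UL.
by rewrite -[_ *: _]addr0; apply: UL => //; exact: SU.
Qed.

(** Bilinearity is asked on an ambient subspace [U] only, since the commutator of arbitrary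
    self-maps of the coordinate ring is not bilinear. Closure passes from generators to the span one
    argument at a time. *)
Lemma linear_span_lie (br : V -> V -> V) S U :
  linear_subspace U -> S `<=` U ->
  (forall a x y z, U x -> U y -> U z ->
    br (a *: x + y) z = a *: br x z + br y z) ->
  (forall a x y z, U x -> U y -> U z ->
    br z (a *: x + y) = a *: br z x + br z y) ->
  (forall x y, S x -> S y -> linear_span S (br x y)) ->
  lie_subalgebra br (linear_span S).
Proof.
move=> hU SU brl brr hS; have hspan := linear_span_subspace S.
have spanU := linear_span_sub hU SU.
split=> // x y Sx Sy.
have br0l z : U z -> br 0 z = 0.
  move=> Uz; have := brl (-1) 0 0 z hU.1 hU.1 Uz.
  by rewrite scaler0 add0r scaleN1r addNr.
have br0r z : U z -> br z 0 = 0.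
  move=> Uz; have := brr (-1) 0 0 z hU.1 hU.1 Uz.
  by rewrite scaler0 add0r scaleN1r addNr.
(* Membership in [U] is built into the set so that the linearity hypotheses apply to its
   elements. *)
pose W z := [set x | U x /\ linear_span S (br x z)].
have hW z : U z -> linear_subspace (W z).
  move=> Uz; split.
    by split; [exact: hU.1|rewrite br0l //; exact: hspan.1].
  move=> a u v [Uu hu] [Uv hv]; split; first exact: hU.2.
  by rewrite brl //; exact: hspan.2.
pose W' z := [set x | U x /\ linear_span S (br z x)].
have hW' z : U z -> linear_subspace (W' z).
  move=> Uz; split.
    by split; [exact: hU.1|rewrite br0r //; exact: hspan.1].
  move=> a u v [Uu hu] [Uv hv]; split; first exact: hU.2.
  by rewrite brr //; exact: hspan.2.
suff /(_ x Sx)[] : linear_span S `<=` W y by [].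
apply: linear_span_sub; first exact/hW/spanU.
move=> s Ss; split; first exact: SU.
suff /(_ y Sy)[] : linear_span S `<=` W' s by [].
apply: linear_span_sub; first exact/hW'/SU.
by move=> t St; split; [exact: SU|exact: hS].
Qed.

End Linear_span.

(** * Restriction of invariant fields to the torus *)

Section Vector_fields.
Variable R : realType.
Local Notation C := (R[i]).
Local Notation inv := (invariant_vector_fields R).
Implicit Types (f : regfun R) (g h : SL2 R) (D E : regfun R -> regfun R).

Lemma invariant_linear D : inv D -> linear D. Proof. by case=> -[]. Qed.

Lemma invariantM D f f' : inv D -> D (f * f') = D f * f' + f * D f'.
Proof. by case=> -[]. Qed.

Lemma invariant_conj D h f : inv D -> D (regfun_conj h f) = regfun_conj h (D f).
Proof. by case. Qed.

Lemma invariant0 D : inv D -> D 0 = 0.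
Proof.
move=> /invariant_linear /(_ (- 1) 0 0).
by rewrite scaler0 add0r scaleN1r addNr.
Qed.

Lemma invariantD D f f' : inv D -> D (f + f') = D f + D f'.
Proof. by move=> /invariant_linear /(_ 1 f f'); rewrite !scale1r. Qed.

Lemma invariantZ D c f : inv D -> D (c *: f) = c *: D f.
Proof.
by move=> hD; have := invariant_linear hD c f 0; rewrite (invariant0 hD) !addr0.
Qed.

Lemma invariantB D f f' : inv D -> D (f - f') = D f - D f'.
Proof.
move=> hD; rewrite -(scaleN1r f') -(scaleN1r (D f')).
by rewrite (invariantD _ _ hD) (invariantZ _ _ hD).
Qed.

Lemma invariant1 D : inv D -> D 1 = 0.
Proof.
move=> hD; have := invariantM 1 1 hD.
by rewrite !mulr1 mul1r -{1}[D 1]addr0 => /addrI.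
Qed.

Lemma invariant_vector_fields_linear : linear_subspace inv.
Proof.
have cE c D E f : (c *: D + E) f = c *: D f + E f by [].
have zE f : (0 : regfun R -> regfun R) f = 0 by [].
split; first split.
- by split=> [c f f'|f f']; rewrite !zE ?scaler0 ?mul0r ?mulr0 addr0.
- by move=> h f; rewrite !zE; apply: regfun_eqP.
- move=> c D E hD hE; split; first split.
  + move=> b f f'; rewrite !cE (invariant_linear hD) (invariant_linear hE).
    by rewrite !scalerDr addrACA !scalerA mulrC.
  + move=> f f'; rewrite !cE (invariantM _ _ hD) (invariantM _ _ hE).
    by apply: regfun_eqP => g; rewrite !(regfunD, regfunZ, regfunM); ring.
  + move=> h f; rewrite !cE (invariant_conj _ _ hD) (invariant_conj _ _ hE).
    exact: regfun_eqP.
Qed.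

Lemma commutator_invariant D E : inv D -> inv E -> inv (commutator R D E).
Proof.
move=> hD hE; split; first split.
- move=> b f f'; rewrite /commutator.
  rewrite !(invariant_linear hE, invariant_linear hD).
  by rewrite scalerBr opprD addrACA.
- move=> f f'; rewrite /commutator.
  rewrite (invariantM _ _ hD) (invariantM _ _ hE).
  rewrite (invariantD _ _ hD) (invariantD _ _ hE).
  by rewrite !(invariantM _ _ hD, invariantM _ _ hE); ring.
- move=> h f; apply: regfun_eqP => g; rewrite /commutator.
  by rewrite !(invariant_conj _ _ hD, invariant_conj _ _ hE).
Qed.

(** At a point fixed by conjugation by [h], invariance forces the value v of [D f] to satisfy v = c
    v. *)
Lemma invariant_torus_eq0 D h f (c z : C) (z0 : z != 0) : inv D ->
  SL2_conj h (torus z0) = torus z0 -> regfun_conj h f = c *: f -> c != 1 ->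
  D f (torus z0) = 0.
Proof.
move=> hD hz hf c1; have : D (regfun_conj h f) (torus z0) = D f (torus z0).
  by rewrite (invariant_conj _ _ hD) /= hz.
rewrite hf (invariantZ _ _ hD) regfunZ => /eqP.
rewrite -subr_eq0 -[X in _ - X]mul1r -mulrBl mulf_eq0 subr_eq0.
by rewrite (negbTE c1) => /eqP.
Qed.

(** Conjugation by diag(2, 1/2) multiplies the off-diagonal entries by 4 and 1/4, neither of which
    is 1. This is the tangency of [D] to the torus. *)
Lemma invariant_offdiag_torus D (i j : 'I_2) (z : C) (z0 : z != 0) : inv D ->
  i != j -> D (entry R i j) (torus z0) = 0.
Proof.
have s0 : (2 : C) != 0 by rewrite pnatr_eq0.
pose t : 'M[C]_2 := torus s0.
have e l m : regfun_conj (torus s0) (entry R l m) =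
    (t l l * (\adj t) m m) *: entry R l m.
  apply: regfun_eqP => g; rewrite regfunZ -[LHS]/(entry R l m _) !entryE.
  rewrite SL2_conjE /t adj_mx2 (mx2_eta g) !mul_mx2.
  by move: l m; do 2!apply: forall_ord2; rewrite !mxE /=; ring.
move=> hD ij; apply: (invariant_torus_eq0 hD (torus_conj s0 z0) (e i j)).
move: i j ij; do 2!apply: forall_ord2; rewrite ?eqxx // => _;
  rewrite /t adj_mx2 !mxE /=.
  by rewrite -natrM pnatr_eq1.
by rewrite -invfM invr_eq1 -natrM pnatr_eq1.
Qed.

(** Apply [D] to the relation det = 1 and restrict to the torus, where the off-diagonal entries
    vanish. *)
Lemma invariant_entry11_torus D (z : C) (z0 : z != 0) : inv D ->
  D (entry R 1 1) (torus z0) = - D (entry R 0 0) (torus z0) / z ^+ 2.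
Proof.
move=> hD.
have hdet : entry R 0 0 * entry R 1 1 - entry R 0 1 * entry R 1 0 = 1.
  apply: regfun_eqP => g; rewrite regfunB !regfunM !entryE -det2 SL2_det.
  by [].
have : D (entry R 0 0) (torus z0) / z + z * D (entry R 1 1) (torus z0) = 0.
  have := congr1 (fun f => D f (torus z0)) hdet.
  rewrite (invariantB _ _ hD) !(invariantM _ _ hD) (invariant1 hD).
  rewrite regfunB !regfunD !regfunM !entryE !mxE /=.
  rewrite (@invariant_offdiag_torus D 0 1) //.
  by rewrite (@invariant_offdiag_torus D 1 0) // !mul0r addr0 subr0.
move=> /eqP; rewrite addr_eq0 => /eqP h.
have -> : D (entry R 0 0) (torus z0) = - (z * D (entry R 1 1) (torus z0)) * z.
  by rewrite -h mulfVK.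
by field; exact: z0.
Qed.

(** The chain rule along the torus, by induction on a polynomial extending [f]: the diagonal entries
    restrict to z and 1/z, the others to 0. One [F] serves all fields [D]. *)
Lemma regfun_torus f : exists F, forall (z : C) (z0 : z != 0),
  f (torus z0) = laurent z F /\
  forall D, inv D ->
    D f (torus z0) * z = D (entry R 0 0) (torus z0) * laurent_euler z F.
Proof.
rewrite [f]regfun_of_extension; move: (extension f).
apply: mpoly_ring_ind => [c|i|P1 P2 [F1 h1] [F2 h2]|P1 P2 [F1 h1] [F2 h2]].
- exists (mkmalgU 0 c) => z z0; rewrite regfun_ofC regfunZ laurentU expr0z.
  split=> // D hD; rewrite laurent_eulerU mul0r !mulr0.
  by rewrite (invariantZ _ _ hD) (invariant1 hD) regfunZ !mulr0 mul0r.
- case/mxvec_indexP: i => i j; rewrite -/(entry R i j).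
  have [ij|ij] := eqVneq i j; last first.
    exists 0 => z z0; rewrite entryE /laurent /laurent_euler !raddf0.
    split=> [|D hD]; last first.
      by rewrite (invariant_offdiag_torus _ hD) // mul0r mulr0.
    by move: i j ij; do 2!apply: forall_ord2; rewrite ?eqxx ?mxE.
  subst j; move: i; apply: forall_ord2.
    exists (mkmalgU 1 1) => z z0; rewrite entryE mxE laurentU laurent_eulerU.
    by rewrite !mul1r.
  exists (mkmalgU (- 1) 1) => z z0; rewrite entryE mxE laurentU laurent_eulerU.
  rewrite !mul1r; split=> // D hD; rewrite (invariant_entry11_torus _ hD).
  rewrite -invr_expz expr1z; field; exact: z0.
- exists (F1 + F2) => z z0; have [e1 d1] := h1 z z0; have [e2 d2] := h2 z z0.
  rewrite regfun_ofD regfunD laurentD laurent_eulerD e1 e2; split=> // D hD.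
  by rewrite (invariantD _ _ hD) regfunD mulrDl mulrDr d1 ?d2.
have [F hF] := laurent_mul F1 F2.
exists F => z z0; have [e1 d1] := h1 z z0; have [e2 d2] := h2 z z0.
have [-> ->] := hF z z0; rewrite regfun_ofM regfunM e1 e2; split=> // D hD.
rewrite (invariantM _ _ hD) regfunD !regfunM e1 e2 mulrDr mulrDl mulrAC.
by rewrite d1 // -!mulrA d2 //; ring.
Qed.

Lemma torus_part_exists D : inv D -> exists u : witt R,
  forall (z : C) (z0 : z != 0),
    D (entry R 0 0) (torus z0) = z * laurent z u.
Proof.
move=> hD; have [F hF] := regfun_torus (D (entry R 0 0)).
(* The field u z d/dz sends the coordinate z to z u, so the restriction of [D (entry R 0 0)] is
   divided by z. *)
have [u hu] := laurent_mul (mkmalgU (- 1) 1) F.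
exists u => z z0; have [-> _] := hF z z0; have [-> _] := hu z z0.
by rewrite laurentU mul1r -invr_expz expr1z mulVKf.
Qed.

(* On the torus an invariant field D is tangent to the torus, equal to
   u(z) z d/dz for the Laurent polynomial u = torus_part D (a junk value
   outside the invariant fields). *)
Definition torus_part D : witt R :=
  xget 0 [set u : witt R | forall (z : C) (z0 : z != 0),
    D (entry R 0 0) (torus z0) = z * laurent z u].

Lemma torus_partE D (z : C) (z0 : z != 0) : inv D ->
  D (entry R 0 0) (torus z0) = z * laurent z (torus_part D).
Proof. by move=> hD; have := xgetPex 0 (torus_part_exists hD); apply. Qed.

Lemma torus_part_unique D u : inv D ->
  (forall (z : C) (z0 : z != 0),
    D (entry R 0 0) (torus z0) = z * laurent z u) -> torus_part D = u.
Proof.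
move=> hD hu; apply: laurent_inj => z z0; apply: (mulfI z0).
by rewrite -(torus_partE z0 hD) hu.
Qed.

Lemma invariant_torusE D f F : inv D ->
  (forall (z : C) (z0 : z != 0), f (torus z0) = laurent z F) ->
  forall (z : C) (z0 : z != 0),
    D f (torus z0) = laurent z (torus_part D) * laurent_euler z F.
Proof.
move=> hD hf z z0; have [G hG] := regfun_torus f.
have -> : F = G.
  by apply: laurent_inj => w w0; rewrite -hf; case: (hG w w0).
apply: (mulIf z0); case: (hG z z0) => _ /(_ D hD) ->.
by rewrite (torus_partE z0 hD); ring.
Qed.

Lemma torus_part_linear c D E : inv D -> inv E ->
  torus_part (c *: D + E) = c *: torus_part D + torus_part E.
Proof.
move=> hD hE; apply: torus_part_unique => [|z z0].
  exact: (invariant_vector_fields_linear.2 _ _ _ hD hE).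
rewrite -[LHS]/(c * D _ _ + E _ _) !torus_partE // laurentD laurentZ; ring.
Qed.

(** Write u, v for the torus parts of X, Y. Then Y sends the coordinate z to z v, hence X Y sends it
    to u (z v + z E(v)) with E = z d/dz; the symmetric term z u v cancels in the commutator. *)
Lemma torus_part_commutator D E : inv D -> inv E ->
  torus_part (commutator R D E) = witt_bracket (torus_part D) (torus_part E).
Proof.
move=> hD hE; apply: torus_part_unique => [|z z0].
  exact: commutator_invariant.
have hcomp X Y : inv X -> inv Y -> X (Y (entry R 0 0)) (torus z0) =
    laurent z (torus_part X) * (z * laurent z (torus_part Y) +
      z * laurent_euler z (torus_part Y)).
  move=> hX hY; have [F hF] := laurent_mul (mkmalgU 1 1) (torus_part Y).
  rewrite (@invariant_torusE X _ F) => [|//|w w0].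
    by case: (hF z z0) => _ ->; rewrite laurentU laurent_eulerU !mul1r.
  by case: (hF w w0) => -> _; rewrite torus_partE // laurentU mul1r.
rewrite laurent_witt_bracket // /commutator regfunB.
rewrite (hcomp _ _ hD hE) (hcomp _ _ hE hD); ring.
Qed.

(** By density it suffices to compare at conjugates of torus points. Invariance moves the
    conjugation onto the function, and on the torus itself the torus part determines the field. *)
Lemma torus_part_inj D E : inv D -> inv E ->
  torus_part D = torus_part E -> D = E.
Proof.
move=> hD hE hDE; apply/funext => f; apply/eqP; rewrite -subr_eq0; apply/eqP.
apply: regfun_dense => h z z0; rewrite regfunB.
rewrite -[D f _]/(regfun_conj h (D f) (torus z0)).
rewrite -[E f _]/(regfun_conj h (E f) (torus z0)).
rewrite -(invariant_conj _ _ hD) -(invariant_conj _ _ hE).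
have [F hF] := regfun_torus (regfun_conj h f).
have {}hF w (w0 : w != 0) : regfun_conj h f (torus w0) = laurent w F.
  by case: (hF w w0).
by rewrite !(invariant_torusE _ hF) // hDE subrr.
Qed.

Lemma torus_partZ c D : inv D -> torus_part (c *: D) = c *: torus_part D.
Proof.
move=> hD; have h0 := invariant_vector_fields_linear.1.
have e0 : torus_part (0 : regfun R -> regfun R) = 0.
  have := torus_part_linear (-1) h0 h0.
  by rewrite scaler0 addr0 scaleN1r addNr.
by have := torus_part_linear c hD h0; rewrite e0 !addr0.
Qed.

Lemma torus_partB D E : inv D -> inv E ->
  torus_part (D - E) = torus_part D - torus_part E.
Proof.
move=> hD hE; rewrite -!(scaleN1r E) -(scaleN1r (torus_part E)).
by rewrite ![_ + -1 *: _]addrC torus_part_linear.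
Qed.

Lemma commutator_linearl c D E F : inv F ->
  commutator R (c *: D + E) F = c *: commutator R D F + commutator R E F.
Proof.
move=> hF; apply/funext => f.
rewrite -[RHS]/(c *: commutator R D F f + commutator R E F f) /commutator.
rewrite -[(_ + _) (F f)]/(c *: D (F f) + E (F f)).
rewrite -[(_ + _) f]/(c *: D f + E f) (invariant_linear hF).
by rewrite scalerBr opprD addrACA.
Qed.

Lemma commutator_linearr c D E F : inv F ->
  commutator R F (c *: D + E) = c *: commutator R F D + commutator R F E.
Proof.
move=> hF; apply/funext => f.
rewrite -[RHS]/(c *: commutator R F D f + commutator R F E f) /commutator.
rewrite -[(_ + _) (F f)]/(c *: D (F f) + E (F f)).
rewrite -[(_ + _) f]/(c *: D f + E f) (invariant_linear hF).
by rewrite scalerBr opprD addrACA.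
Qed.

End Vector_fields.

(** * The fields of equivariant maps and the family [Psi] *)

Section Psi.
Variable R : realType.
Local Notation C := (R[i]).
Local Notation inv := (invariant_vector_fields R).

Lemma eq_dir_derivative (P Q : mpoly (2 * 2) C) (A B X Y : 'M[C]_2) :
  (forall t, mx_eval P (A + t *: X) = mx_eval Q (B + t *: Y)) ->
  dir_derivative P A X = dir_derivative Q B Y.
Proof.
move=> PQ; rewrite /dir_derivative.
suff -> : (fun t : C => mx_eval P (A + t *: X) : C^o) =
  (fun t : C => mx_eval Q (B + t *: Y) : C^o) by [].
exact/funext.
Qed.

(** [vector_fieldE] allows any extension, so each identity uses the fitting one: a linear
    combination, a product, or a conjugate. Equivariance of [Phi] matches the directions in the last
    case. *)
Lemma vector_field_invariant (Phi : equivariant_map R) :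
  inv (vector_field Phi).
Proof.
split; first split.
- move=> c f f'; apply: regfun_eqP => g.
  rewrite (@vector_fieldE _ _ _ (c *: extension f + extension f')); last first.
    move=> k; rewrite mx_evalD /mx_eval mevalZ regfunD regfunZ.
    by rewrite !extensionP.
  rewrite regfunD regfunZ !(vector_fieldE _ _ (@extensionP _ _)).
  rewrite !dir_derivativeE mulr_sumr -big_split; apply: eq_bigr => i _ /=.
  by rewrite mderivD mderivZ mx_evalD /mx_eval mevalZ mulrDl mulrA.
- move=> f f'; apply: regfun_eqP => g.
  rewrite (@vector_fieldE _ _ _ (extension f * extension f')); last first.
    by move=> k; rewrite mx_evalM regfunM !extensionP.
  rewrite regfunD !regfunM !(vector_fieldE _ _ (@extensionP _ _)).
  rewrite !dir_derivativeE (extensionP f) (extensionP f').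
  rewrite mulr_suml mulr_sumr -big_split; apply: eq_bigr => i _ /=.
  by rewrite mderivM mx_evalD !mx_evalM; ring.
- move=> h f; apply: regfun_eqP => g.
  have [Q hQ] := mx_eval_conj (extension f) h (invmx h).
  rewrite (@vector_fieldE _ _ _ Q) => [|k]; last first.
    by rewrite hQ -[LHS]/(f (SL2_conj h k)) (extensionP f).
  rewrite -[RHS]/(vector_field Phi f (SL2_conj h g)).
  rewrite (vector_fieldE _ _ (@extensionP _ _)) equiv_conj.
  apply: eq_dir_derivative => t.
  rewrite hQ mulmxDr mulmxDl -scalemxAr -scalemxAl /=.
  by rewrite !mulmxA mulmxKV ?SL2_unit.
Qed.

Lemma dir_derivative_entry (i j : 'I_2) (A X : 'M[C]_2) :
  dir_derivative (mpolyX _ (mnm1 (mxvec_index i j))) A X = X i j.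
Proof.
rewrite dir_derivativeE (bigD1 (mxvec_index i j)) //= big1 => [|k kij].
  rewrite mderivX mnm1E eqxx scale1r (_ : mnm_sub _ _ = mnm0); last first.
    by apply/mnmP => k; rewrite mnmBE subnn mnm0E.
  by rewrite mpolyX0 /mx_eval meval1 addr0 mul1r /mx_coord mxvecE.
by rewrite mderivX mnm1E eq_sym (negbTE kij) scale0r /mx_eval meval0 mul0r.
Qed.

Lemma expr_diag (a d : C) n :
  (mx2 a 0 0 d : 'M_2) ^+ n = mx2 (a ^+ n) 0 0 (d ^+ n).
Proof.
elim: n => [|n ih]; first by rewrite !expr0 [LHS]mx2_eta !mxE.
by rewrite !exprS ih [LHS]mul_mx2; congr mx2; ring.
Qed.

Lemma torus_exprz (z : C) (z0 : z != 0) (m : int) :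
  (torus z0 : 'M_2) ^ m = mx2 (z ^ m) 0 0 (z ^ - m).
Proof.
case: m => n; first by rewrite -exprnP [LHS]expr_diag exprVn -exprnN.
rewrite NegzE opprK -exprnN -exprVn -[_^-1]/(invmx (torus z0)) SL2_adj.
by rewrite adj_mx2 oppr0 expr_diag exprVn -exprnN.
Qed.

Lemma Psi_invariant m : inv (Psi R m).
Proof. exact: vector_field_invariant. Qed.

(** At g = diag(z, 1/z) the direction g (g^m - g^-m) has upper left entry z (z^m - z^-m). *)
Lemma torus_part_Psi m :
  torus_part (Psi R m) = mkmalgU m 1 - mkmalgU (- m) 1.
Proof.
apply: torus_part_unique => [|z z0]; first exact: Psi_invariant.
rewrite (@vector_fieldE _ _ _ (mpolyX _ (mnm1 (mxvec_index 0 0)))) //.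
rewrite dir_derivative_entry /= /Psi_fun !torus_exprz opprK.
by rewrite laurentB !laurentU !mul1r !mxE !big_ord_recl big_ord0 !mxE /=; ring.
Qed.

(** Holds for all integers, which covers every sign of [l - k]. Injectivity of the torus part
    reduces it to an identity in the Witt algebra. *)
Lemma commutator_Psi k l : commutator R (Psi R k) (Psi R l) =
  (l - k)%:~R *: Psi R (k + l) - (k + l)%:~R *: Psi R (l - k).
Proof.
have hinv := invariant_vector_fields_linear R.
have hZ c m : inv (c *: Psi R m).
  exact: (linear_subspaceZ _ hinv (Psi_invariant m)).
have hB c m : torus_part (c *: Psi R m) = c *: torus_part (Psi R m).
  by rewrite torus_partZ //; exact: Psi_invariant.
apply: torus_part_inj.
- exact: commutator_invariant (Psi_invariant _) (Psi_invariant _).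
- exact: (linear_subspaceB hinv (hZ _ _) (hZ _ _)).
rewrite (torus_partB (hZ _ _) (hZ _ _)) !hB.
rewrite (torus_part_commutator (Psi_invariant k) (Psi_invariant l)).
(* Evaluated at [z], both sides become rational expressions in [z ^ k] and [z ^ l]. *)
rewrite !torus_part_Psi; apply: laurent_inj => z z0.
rewrite laurent_witt_bracket // !(laurentB, laurentZ) laurent_eulerB.
rewrite laurent_eulerB !laurent_eulerU !laurentU !mul1r.
rewrite !opprD !opprK !expfzDr // -!invr_expz !(intrD, intrN) //=.
have zk : z ^ k != 0 by rewrite expfz_neq0.
have zl : z ^ l != 0 by rewrite expfz_neq0.
by field; rewrite zk zl.
Qed.

Lemma PsiN m : Psi R (- m) = - Psi R m.
Proof.
have hinv := invariant_vector_fields_linear R.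
have hm := Psi_invariant m.
apply: torus_part_inj; first exact: Psi_invariant.
  by rewrite -scaleN1r; exact: linear_subspaceZ.
by rewrite -scaleN1r torus_partZ // !torus_part_Psi opprK scaleN1r opprB.
Qed.

Lemma Psi0 : Psi R 0 = 0.
Proof.
have h := PsiN 0; rewrite oppr0 in h.
have : (2 : C) *: Psi R 0 = 0.
  rewrite -[2]/(1 + 1) scalerDl scale1r {1}h; exact: addNr.
move=> h2; rewrite -[LHS](scalerK (a := 2%:R : C)) ?pnatr_eq0 // h2.
exact: scaler0.
Qed.

(** Brackets of generators involve the index [l - k], possibly zero or negative; [Psi0] and [PsiN]
    bring it back to the generators. *)
Lemma even_Psi_span m : linear_span [set D | exists2 k : nat,
  (1 <= k)%N & D = Psi R (2 * k%:Z)] (Psi R (2 * m)).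
Proof.
set G := (X in linear_span X); have sub := linear_span_subspace G.
have pos (k : nat) : linear_span G (Psi R (2 * k%:Z)).
  case: k => [|k]; first by rewrite mulr0 Psi0; exact: sub.1.
  by apply: linear_span_gen; exists k.+1.
case: m => k; first exact: pos.
by rewrite NegzE mulrN PsiN -scaleN1r; apply: linear_subspaceZ.
Qed.

End Psi.

Theorem theorem4p5 (R : realType) :
  [/\ forall k : nat, (1 <= k)%N -> invariant_vector_fields R (Psi R k%:Z),
      forall k l : nat, (1 <= k)%N -> (1 <= l)%N ->
        commutator R (Psi R k%:Z) (Psi R l%:Z) =
        (l%:Z - k%:Z)%:~R *: Psi R (k%:Z + l%:Z)
          - (k%:Z + l%:Z)%:~R *: Psi R (l%:Z - k%:Z),
      lie_subalgebra (commutator R) (invariant_vector_fields R),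
      exists (T : set (witt R))
             (phi : (regfun R -> regfun R) -> witt R),
        lie_subalgebra (@witt_bracket R) T /\
        lie_isomorphism (commutator R) (@witt_bracket R)
          (invariant_vector_fields R) T phi
    & let even_span := linear_span [set D | exists2 k : nat,
          (1 <= k)%N & D = Psi R (2 * k%:Z)] in
      even_span `<=` invariant_vector_fields R /\
      lie_subalgebra (commutator R) even_span].
Proof.
have hinv := invariant_vector_fields_linear R.
have hcomm D E := @commutator_invariant R D E.
split=> [k _|k l _ _|//||even_span].
- exact: Psi_invariant.
- exact: commutator_Psi.
(* Taking the image as [T] makes surjectivity immediate; the compatibility of [torus_part] with the
   operations makes [T] a subalgebra. *)
- exists ((@torus_part R) @` invariant_vector_fields R), (@torus_part R).
  split; first split; first split.
  + exists 0; first exact: hinv.1.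
    rewrite -(scale0r (0 : regfun R -> regfun R)) torus_partZ ?scale0r //.
    exact: hinv.1.
  + move=> c _ _ [D hD <-] [E hE <-]; exists (c *: D + E).
      exact: hinv.2.
    exact: torus_part_linear.
  + move=> _ _ [D hD <-] [E hE <-].
    exists (commutator R D E); first exact: hcomm.
    exact: torus_part_commutator.
  + split; [|exact: torus_part_linear|exact: torus_part_commutator].
    split=> [D hD|D E /set_mem hD /set_mem hE|_ [D hD <-]]; try by exists D.
    exact: torus_part_inj.
- have sub : even_span `<=` invariant_vector_fields R.
    apply: linear_span_sub => // _ [k _ ->]; exact: Psi_invariant.
  split=> //; apply: (linear_span_lie hinv).
  + by move=> _ [k _ ->]; exact: Psi_invariant.
  + by move=> c D E F hD hE hF; exact: commutator_linearl.
  + by move=> c D E F hD hE hF; exact: commutator_linearr.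
  + move=> _ _ [k _ ->] [l _ ->]; rewrite commutator_Psi.
    (* Sums and differences of even indices are again of the form [2 * m]. *)
    rewrite -mulrDr -mulrBr; have ssub := linear_span_subspace.
    apply: linear_subspaceB => //;
      by apply: linear_subspaceZ => //; exact: even_Psi_span.
Qed.
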